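(* Consider the switched system $\dot{\mathbf{x}}(t)=\mathbf{f}_i(\mathbf{x}(t))$, $i\in I=\{1,\dots,k\}$, on $\Omega\subseteq\mathbb{R}^d$, satisfying the standing assumptions listed in the context. Suppose there exists a function $V\in C^1(\Omega)$ with $V(\mathbf{0})=0$ and a function $\gamma$ with $\gamma(r)>0$ for all $r\neq 0$ such that $$\nabla V(\mathbf{x})\cdot\mathbf{f}_i(\mathbf{x})\le-\gamma(\|\mathbf{x}\|)\quad\text{and}\quad V(\mathbf{x})>0$$ for all $i\in I$ and all $\mathbf{x}\in C_i\setminus\{\mathbf{0}\}$. Then the equilibrium $\mathbf{x}_0=\mathbf{0}$ of the switched system is uniformly asymptotically stable. Moreover, if $R>0$ is such that the level set $$S_R:=\{\mathbf{x}\in\Omega: V(\mathbf{x})\le R\}\subseteq\Omega^\circ$$ is compact, then $S_R$ is a subset of the basin of attraction $A(\mathbf{0})$ of $\mathbf{x}_0$.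
   Context: Switched system (standing assumptions). $\Omega\subseteq\mathbb{R}^d$ is a bounded domain with Lipschitz boundary, with $\mathbf{0}\in\Omega^\circ$ (the interior). $I=\{1,\dots,k\}$ is finite. The sets $C_i\subseteq\Omega$, $i\in I$, are closed and $\bigcup_{i\in I}C_i=\Omega$. For each $i\in I$, $\mathbf{f}_i$ is the restriction to $C_i$ of a $C^{\alpha-1}$ vector field defined on an open neighbourhood of $C_i$, where $\alpha>d/2+2$. If $\mathbf{0}\in C_i$ then $\mathbf{f}_i(\mathbf{0})=\mathbf{0}$. Switching sequences and trajectories. A switching sequence indexed by an initial state $\mathbf{x}\in\Omega$ is $\sigma=\{(i_0,0),(i_1,t_1),\dots,(i_j,t_j),\dots\}$ with $i_j\in I$ and increasing switching times $t_0=0,t_1,t_2,\dots$; the pair $(i_j,t_j)$ means that the trajectory evolves according to $\dot{\mathbf{x}}(t)=\mathbf{f}_{i_j}(\mathbf{x}(t))$ for $t_j\le t<t_{j+1}$. Here the system with index $i$ may be active only while the trajectory lies in $C_i$ (in overlaps of the $C_i$ the index may switch arbitrarily; a switch must occur when the trajectory leaves the set where the active system is defined). Trajectories are continuous and $\mathbf{x}(t)\in\Omega$ for $t$ in the maximal interval of existence. Only finitely many switches occur in finite time. $\Sigma_{\mathbf{x}}$ is the set of all switching sequences that can occur starting from $\mathbf{x}$. For $\sigma\in\Sigma_{\mathbf{x}}$, the $\sigma$-flow $S_\sigma(\mathbf{x},t)=\mathbf{x}_\sigma(t)$ is the state at time $t$ of the trajectory starting at $\mathbf{x}$ at time $0$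 and following $\sigma$; in particular $S_\sigma(\mathbf{x},0)=\mathbf{x}$. Stability. $\mathbf{x}_0=\mathbf{0}$ is stable if for all $\varepsilon>0$ there exists $\delta>0$ such that for all $t\ge0$ the solution exists and $\|\mathbf{x}\|<\delta$ implies $\|S_\sigma(\mathbf{x},t)\|<\varepsilon$ for all $\sigma\in\Sigma_{\mathbf{x}}$. It is uniformly asymptotically stable if it is stable and there exists $\delta'>0$ such that for all $\varepsilon>0$ there exists $T>0$ such that for all $t>T$: $\|\mathbf{x}\|<\delta'$ implies $\|S_\sigma(\mathbf{x},t)\|<\varepsilon$ for all $\sigma\in\Sigma_{\mathbf{x}}$. The basin of attraction is $A(\mathbf{0})=\{\mathbf{x}\in\Omega:\ \forall\sigma\in\Sigma_{\mathbf{x}},\ \lim_{t\to\infty}S_\sigma(\mathbf{x},t)=\mathbf{0}\}$.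
   Formalization: Switching sequences whose maximal trajectory stops at an interior point of Ω because no continuation exists there (sliding dead ends) are not counted in Σ_x; if they were, existence for all t≥0 would fail. Trajectories that may leave Ω are kept. *)

(* Defs.v *)
(* MathComp-Analysis, over an arbitrary [R : realType]; R^d is ['rV[R]_d]. *)
From HB Require Import structures.
From mathcomp Require Import all_boot all_order all_algebra.
From mathcomp Require Import all_classical all_reals all_analysis.

Set Implicit Arguments.
Unset Strict Implicit.
Unset Printing Implicit Defensive.

Import Order.TTheory GRing.Theory Num.Theory.
Import numFieldNormedType.Exports.

Local Open Scope classical_set_scope.
Local Open Scope ring_scope.

Section Euclidean.
Context {R : realType} {d : nat}.
Implicit Types u v : 'rV[R]_d.

(* The library norm [`|u|] on ['rV[R]_d] is the sup norm.  It induces the usual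
   topology, but norms occurring in the mathematics are Euclidean. *)
Definition dot u v : R := \sum_(i < d) u 0 i * v 0 i.
Definition enorm u : R := Num.sqrt (dot u u).

End Euclidean.

Section Regularity.
Context {R : realType} {d : nat}.
Local Notation V := 'rV[R]_d.

Definition locally_Holder (W : normedModType R) (beta : R) (U : set V)
    (f : V -> W) : Prop :=
  forall x, U x -> exists M : R, exists2 e : R, 0 < e &
    forall y z, ball x e y -> ball x e z ->
      `|f y - f z| <= M * `|y - z| `^ beta.

(* Intended for [U] open. *)
Fixpoint of_class (m : nat) (beta : R) (U : set V) (f : V -> V) : Prop :=
  (forall x, U x -> {for x, continuous f}) /\
  match m with
  | 0%N => locally_Holder beta U f
  | m'.+1 => forall j : 'I_d,
      let e_j : V := delta_mx 0 j in
      (forall x, U x -> derivable f x e_j) /\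
      of_class m' beta U (fun x => 'D_e_j f x)
  end.

(* C^s for a real exponent s >= 0: the partial derivatives of order up to
   floor(s) exist and are continuous, and those of order floor(s) are locally
   Hoelder with exponent s - floor(s).  If s is an integer, this exponent is 0
   and the Hoelder condition is mere local boundedness (recall a `^ 0 = 1), which
   is implied by continuity: one gets the usual C^s. *)
Definition C_class (s : R) (U : set V) (f : V -> V) : Prop :=
  of_class (Num.truncn s) (s - (Num.truncn s)%:R) U f.

(* [g] is C^1 on [Om], with gradient [Dg].  [Om] need not be open: [g] is C^1 in
   the interior, and [g] and its gradient are continuous up to the part of the
   boundary belonging to [Om] (which determines [Dg] on [Om] as soon as [Om] is
   contained in the closure of its interior). *)
Definition C1_on (Om : set V) (g : V -> R) (Dg : V -> V) : Prop :=
  [/\ {within Om, continuous g},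
      {within Om, continuous Dg} &
      forall x, interior Om x ->
        differentiable g x /\ forall v, 'd g x v = dot (Dg x) v].

(* Near each boundary point, in suitable orthonormal coordinates, [Om] is the
   set of points above the graph of a Lipschitz function.  [e] is the unit
   vector of the "vertical" axis, and [psi] is only used on the hyperplane
   orthogonal to [e].  Whether boundary points belong to [Om] is left open. *)
Definition Lipschitz_boundary (Om : set V) : Prop :=
  forall p, closure Om p -> ~ interior Om p ->
  exists (e : V) (psi : V -> R) (L : R) (U : set V),
  [/\ enorm e = 1,
      (forall u v, `|psi u - psi v| <= L * enorm (u - v)),
      open U, U p &
      forall x, U x ->
        let base := x - dot x e *: e in
        (interior Om x <-> psi base < dot x e) /\
        (closure Om x <-> psi base <= dot x e)].

End Regularity.

Record switched_system (R : realType) (d k : nat) := SwitchedSystem {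
  dom : set 'rV[R]_d;
  cell : 'I_k -> set 'rV[R]_d;
  field : 'I_k -> 'rV[R]_d -> 'rV[R]_d  (* [field i] is relevant on [cell i] *)
}.

(* The domain is not required to be open or closed, and the cells are closed
   relative to it.  If the domain is closed, then the cells are closed in R^d;
   conversely, cells closed in R^d force their finite union, the domain, to be
   closed. *)
Record standing_assumptions (R : realType) (d k : nat) (alpha : R)
    (S : switched_system R d k) : Prop := StandingAssumptions {
  dom_bounded : bounded_set (dom S);
  dom_connected : connected (interior (dom S));
  dom_Lipschitz : Lipschitz_boundary (dom S);
  dom_origin : interior (dom S) 0;
  cell_closed : forall i, exists2 F, closed F & cell S i = dom S `&` F;
  cell_cover : \bigcup_(i in [set: 'I_k]) cell S i = dom S;
  alpha_large : d%:R / 2 + 2 < alpha;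
  field_class : forall i,
    exists (U : set 'rV[R]_d) (F : 'rV[R]_d -> 'rV[R]_d),
    [/\ open U, cell S i `<=` U, C_class (alpha - 1) U F &
        forall x, cell S i x -> field S i x = F x];
  field_origin : forall i, cell S i 0 -> field S i 0 = 0
}.

(* [swtime s j] is t_j; a sequence with finitely many switches is encoded by
   t_j = +oo from some rank on.  The last condition forbids accumulation of
   switches in finite time. *)
Record switching (R : realType) (k : nat) := Switching {
  swidx : nat -> 'I_k;
  swtime : nat -> \bar R;
  swtime0 : swtime 0 = 0%E;
  swtime_incr : forall j, (swtime j < swtime j.+1)%E \/
                          swtime j = +oo%E /\ swtime j.+1 = +oo%E;
  swtime_unbounded : forall T : R, exists j, (T%:E < swtime j)%E
}.

Section Dynamics.
Context {R : realType} {d k : nat}.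
Variable S : switched_system R d k.
Implicit Types (s : switching R k) (x : 'rV[R]_d).
Implicit Types (J : set R) (phi : R -> 'rV[R]_d).

Definition phase s J (j : nat) : set R :=
  J `&` [set t | (swtime s j <= t%:E)%E /\ (t%:E < swtime s j.+1)%E].

(* The derivative is one-sided at the end points of a phase. *)
Definition trajectory s x J phi : Prop :=
  [/\ [/\ is_interval J, J 0 & forall t, J t -> 0 <= t],
      phi 0 = x,
      {within J, continuous phi},
      (forall t, J t -> dom S (phi t)) &
      forall j t, phase s J j t ->
        cell S (swidx s j) (phi t) /\
        (fun r => (r - t)^-1 *: (phi r - phi t))
          @ within (phase s J j) t^' --> field S (swidx s j) (phi t)].

Definition maximal_trajectory s x J phi : Prop :=
  trajectory s x J phi /\
  forall s' J' phi', trajectory s' x J' phi' -> J `<=` J' ->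
    (forall t, J t -> phi' t = phi t) -> J' = J.

(* Towards the end of [J], [phi] leaves every compact subset of the interior. *)
Definition exits_domain J phi : Prop :=
  forall K, compact K -> K `<=` interior (dom S) ->
  forall t, J t -> exists2 t', J t' & t <= t' /\ ~ K (phi t').

(* The motion of the system from [x] along [s], on its maximal interval of
   existence [J].  As for an ordinary differential equation, a bounded [J] is
   possible only because the trajectory exits the domain.  This makes precise
   which switching sequences "can occur": sequences after which no continuation
   is possible at a point inside the domain (for instance where the fields of
   two adjacent cells both point into the other cell) are excluded, since
   the evolution they prescribe cannot take place. *)
Definition motion s x J phi : Prop :=
  maximal_trajectory s x J phi /\
  (J = [set t | 0 <= t] \/ exits_domain J phi).

Definition Sigma x : set (switching R k) :=
  [set s | exists J phi, motion s x J phi].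

(* For [s] in [Sigma x], the maximal interval of existence and the s-flow.
   The fields being C^1, the motion along a given [s] is unique. *)
Definition the_motion s x : set R * (R -> 'rV[R]_d) :=
  xget (set0, cst 0) [set p | motion s x p.1 p.2].
Definition lifespan s x : set R := (the_motion s x).1.
Definition flow s x (t : R) : 'rV[R]_d := (the_motion s x).2 t.

Definition stable : Prop :=
  forall eps : R, 0 < eps -> exists2 delta : R, 0 < delta &
  forall t : R, 0 <= t -> forall x, dom S x -> enorm x < delta ->
  forall s, Sigma x s -> lifespan s x t /\ enorm (flow s x t) < eps.

Definition uniformly_asymptotically_stable : Prop :=
  stable /\
  exists2 delta : R, 0 < delta &
  forall eps : R, 0 < eps -> exists2 T : R, 0 < T &
  forall t : R, T < t -> forall x, dom S x -> enorm x < delta ->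
  forall s, Sigma x s -> lifespan s x t /\ enorm (flow s x t) < eps.

Definition basin : set 'rV[R]_d :=
  [set x | dom S x /\ forall s, Sigma x s ->
     (forall t, 0 <= t -> lifespan s x t) /\
     flow s x t @[t --> +oo] --> (0 : 'rV[R]_d)].

End Dynamics.

(* Main.v *)
Require Import Defs.
From HB Require Import structures.
From mathcomp Require Import all_boot all_order all_algebra.
From mathcomp Require Import all_classical all_reals all_analysis.
From mathcomp Require Import ring lra.
Import Order.TTheory GRing.Theory Num.Theory.
Import numFieldNormedType.Exports.
Local Open Scope classical_set_scope.
Local Open Scope ring_scope.

(** Along any motion that stays in the interior of the domain, [V] is
    nonincreasing, whatever the switching: every time [t] belongs to some
    phase, so the motion has at [t] a right derivative equal to an active
    field, and [V] along the motion has there the right derivative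
    [dot gradV field <= 0].  A continuous function whose right derivatives are
    bounded by [c] at all points satisfies the mean value inequality with
    constant [c] ([right_slope_le]), so the switching times need not be singled
    out.  This gives [lyapunov_decrease].

    The central objects are the sets [sublevel V O c] with [O] an open part of
    the domain.  If such a set is compact, no motion can leave it: at a time
    when the motion is in the set it is inside [O], hence it remains in [O] for
    a while, and during that while [V] does not increase ([sublevel_trap]).  A
    motion that stays in a compact subset of the interior does not exit the
    domain, so it lives for ever ([sublevel_motion]).

    Two kinds of sets are of this form: the level set of the theorem, with [O]
    the interior of the domain, and arbitrarily small neighbourhoods of the
    origin, with [O] a small ball and [c] smaller than the minimum of [V] on its
    boundary sphere ([small_sublevel]); they are neighbourhoods because [V] is
    continuous and vanishes at the origin.  The latter sets give stability.

    For attraction, fix a compact [sublevel V O c] and a small trapping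
    neighbourhood of the origin.  Away from the origin, compactness and the
    continuity of [gradV] and of the fields turn the pointwise strict decrease
    into a uniform rate [mu > 0] ([lyapunov_strict]).  As [V] is nonnegative, a
    motion along which [V] decreases at the rate [mu] cannot last for more than
    about [c / mu]; by then it has entered the small neighbourhood, where it is
    trapped ([sublevel_attraction]).  The time depends only on the two sets: this is
    both the uniform attraction near the origin and the inclusion of the level
    set in the basin.  All this holds for every motion along a given switching
    sequence, hence for the selected one that defines the flow. *)

(** * Right derivatives *)

(** There is a last time in [[a, b]] at which [g] is in [K], because [K] is
    closed, and the continuation hypothesis forbids it to be less than [b]. *)
Lemma closed_continuation (R : realType) (T : topologicalType) (g : R -> T)
    (K : set T) (a b : R) :
  a <= b -> {within `[a, b], continuous g} -> closed K -> K (g a) ->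
  (forall t, a <= t < b -> K (g t) -> exists2 s, t < s <= b & K (g s)) ->
  K (g b).
Proof.
move=> ab /subspace_continuousP gC Kcl Ka step.
set E := [set t | a <= t <= b /\ K (g t)].
have Ea : E a by split=> //; rewrite lexx.
have Eub : ubound E b by move=> t [/andP[]].
have Esup : has_sup E by split; [exists a | exists b].
have am : a <= sup E by apply: sup_upper_bound.
have mb : sup E <= b by apply: ge_sup => //; exists a.
have Km : K (g (sup E)).
  apply: contrapT => nKm.
  have /gC : `[a, b]%classic (sup E) by rewrite /= in_itv /= am mb.
  move=> /(_ (~` K)); case.
    by apply: open_nbhs_nbhs; split=> //; exact: closed_openC.
  move=> e /= e0 he; have [s Es ms] := sup_adherent e0 Esup.
  have [asb Ks] := Es.
  have sm : s <= sup E by exact: sup_upper_bound.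
  apply: (he s) => //=; rewrite ?in_itv //=.
  by rewrite ger0_norm ?subr_ge0 // ltrBlDr addrC -ltrBlDr.
move: mb; rewrite le_eqVlt => /predU1P[<- //|mb].
have [|s /andP[ms sb] Ks] := step _ _ Km; first by rewrite am.
have : s <= sup E.
  apply: sup_upper_bound => //; split=> //.
  by rewrite sb (ltW (le_lt_trans am ms)).
by rewrite leNgt ms.
Qed.

(** The mean value inequality for one-sided derivatives: for each [e > 0],
    [w t - (c + e) * t] has negative right derivatives, so that a time at which
    it is at most its initial value is followed by other such times. *)
Lemma right_slope_le (R : realType) (w : R -> R) (a b c : R) :
  a <= b -> {within `[a, b], continuous w} ->
  (forall t, a <= t < b ->
     exists2 l, (r - t)^-1 * (w r - w t) @[r --> t^'+] --> l & l <= c) ->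
  w b - w a <= c * (b - a).
Proof.
move=> ab wC slope; apply/ler_addgt0Pr => e e0.
(* The [+ 1] keeps the denominator positive when [a = b]. *)
pose e' := e / (b - a + 1).
have ba0 : 0 < b - a + 1 by lra.
have e'0 : 0 < e' by rewrite divr_gt0.
pose g t := w t - (c + e') * t.
suff : g b <= g a.
  have : e' * (b - a + 1) = e by rewrite mulfVK // gt_eqF.
  rewrite /g; nra.
apply: (@closed_continuation _ _ g [set y | y <= g a] a b ab) => //=.
- move=> x; apply: cvgB; first exact: wC.
  apply: cvgM; first exact: cvg_cst.
  by apply: continuous_subspaceT => y; exact: cvg_id.
move=> t /andP[at_ tb] gt.
have [|l wl lc] := slope t; first by rewrite at_.
have /wl : nbhs l [set y | y < c + e'].
  by apply: open_nbhs_nbhs; split; [exact: open_lt|rewrite /=; lra].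
rewrite /= => hw.
have : \forall s \near t^'+, t < s <= b /\ (s - t)^-1 * (w s - w t) < c + e'.
  near=> s; split; last by near: s.
  apply/andP; split; near: s; first exact: nbhs_right_gt.
  exact: nbhs_right_le.
move=> /filter_ex[s [/andP[ts sb] hs]]; exists s; first by rewrite ts.
have st : 0 < s - t by rewrite subr_gt0.
move: hs; rewrite mulrC ltr_pdivrMr // /g => hs.
by apply: le_trans gt; rewrite /g; nra.
Unshelve. all: by end_near. Qed.

(** One-sided chain rule.  It is obtained from the first-order expansion of [V]:
    the remainder, divided by [r - t], is small compared with the difference
    quotient of [phi], which is bounded as it converges. *)
Lemma right_derivative_comp (R : realType) (d : nat) (V : 'rV[R]_d -> R)
    (phi : R -> 'rV[R]_d) (t : R) (v : 'rV[R]_d) :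
  differentiable V (phi t) ->
  (r - t)^-1 *: (phi r - phi t) @[r --> t^'+] --> v ->
  (r - t)^-1 * (V (phi r) - V (phi t)) @[r --> t^'+] --> 'd V (phi t) v.
Proof.
move=> Vd qv.
set D := 'd V (phi t); set q := fun r => (r - t)^-1 *: (phi r - phi t).
have Dc : continuous D by exact: diff_continuous.
have h0 : phi r - phi t @[r --> t^'+] --> (0 : 'rV[R]_d).
  have : (r - t) *: q r @[r --> t^'+] --> ((t - t) *: v).
    apply: cvgZ => //; apply: cvgB; last exact: cvg_cst.
    exact: cvg_within.
  rewrite subrr scale0r; apply: cvg_trans; apply: near_eq_cvg.
  apply: filterS (nbhs_right_gt t) => r tr.
  by rewrite /q scalerA divff ?scale1r // subr_eq0 gt_eqF.
have /eqaddoP Vo := diff_locally Vd.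
have Dq : D (q r) @[r --> t^'+] --> D v.
  by apply: continuous_cvg => //; exact: Dc.
move/cvgrPdist_le: qv => qv; move/cvgrPdist_le: Dq => Dq.
apply/cvgrPdist_le => e e0.
pose h r := phi r - phi t.
pose N := `|v| + 1.
have N0 : 0 < N by rewrite /N ltr_wpDl.
have Voh eta : 0 < eta -> \forall r \near t^'+,
    `|(V \o shift (phi t) - (cst (V (phi t)) + D)) (h r)| <= eta * `|h r|.
  by move=> /Vo; exact: h0.
near=> r.
have rt : 0 < r - t by rewrite subr_gt0; near: r; exact: nbhs_right_gt.
have qN : `|q r| <= N.
  have : `|v - q r| <= 1.
    by near: r; apply: qv.
  rewrite /N => ?; rewrite -[q r](subrK v) addrC.
  by apply: le_trans (ler_normD _ _) _; rewrite lerD2l distrC.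
have hD : `|D v - D (q r)| <= e / 2.
  by near: r; apply: Dq; rewrite divr_gt0.
have ho : `|V (phi r) - V (phi t) - D (h r)| <= e / 2 / N * `|h r|.
  have : `|(V \o shift (phi t) - (cst (V (phi t)) + D)) (h r)|
      <= e / 2 / N * `|h r|.
    by near: r; apply: Voh; rewrite !divr_gt0.
  by rewrite /= !fctE /= /cst /h subrK opprD addrA.
(* Split into the error on the linear part and the remainder. *)
have -> : D v - (r - t)^-1 * (V (phi r) - V (phi t)) =
   (D v - D (q r)) - (r - t)^-1 * (V (phi r) - V (phi t) - D (h r)).
  have -> : D (q r) = (r - t)^-1 * D (h r) by exact: linearZ.
  by ring.
apply: le_trans (ler_normB _ _) _.
rewrite [e]splitr; apply: lerD => //.
rewrite normrM gtr0_norm ?invr_gt0 // mulrC ler_pdivrMr //.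
apply: (le_trans ho).
have -> : `|h r| = (r - t) * `|q r|.
  by rewrite /q normrZ gtr0_norm ?invr_gt0 // mulVKf ?gt_eqF.
rewrite mulrCA [leRHS]mulrC ler_pM2l //.
rewrite -[leLHS]mulrA ger_pMr ?divr_gt0 //.
by rewrite mulrC ler_pdivrMr // mul1r.
Unshelve. all: by end_near. Qed.

(** * Decrease of a Lyapunov function along motions *)

(** Restricting the level set to [O] makes it possible to treat alike the level
    sets of the whole domain and their pieces near the origin. *)
Definition sublevel {R : realType} {T : Type} (V : T -> R) (O : set T) (c : R)
  : set T := O `&` [set y | V y <= c].

Section Lyapunov.
Context {R : realType} {d k : nat} {S : switched_system R d k}.
Implicit Types (s : switching R k) (x y : 'rV[R]_d) (J : set R)
  (phi : R -> 'rV[R]_d) (O C : set 'rV[R]_d).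

Lemma active_phase s (t : R) : 0 <= t ->
  exists j, (swtime s j <= t%:E)%E /\ (t%:E < swtime s j.+1)%E.
Proof.
move=> t0; have [j] := swtime_unbounded s t.
elim: j => [|j IH]; first by rewrite swtime0 lte_fin ltNge t0.
by case: (leP (swtime s j) t%:E) => [sj tj|/IH//]; exists j.
Qed.

(** Phases are closed on the left and open on the right, so that a right
    neighbourhood of [t] lies in the phase of [t], even if [t] is a switching
    time.  The time [b] ensures that the trajectory goes on after [t]. *)
Lemma trajectory_right_derivative s x J phi t b :
  trajectory S s x J phi -> J b -> 0 <= t < b ->
  exists2 i, cell S i (phi t) &
    (r - t)^-1 *: (phi r - phi t) @[r --> t^'+] --> field S i (phi t).
Proof.
move=> [[Jitv J0 _] _ _ _ ph] Jb /andP[t0 tb].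
have Jt r : 0 <= r <= b -> J r by exact: Jitv.
have [j [sj tj]] := active_phase s t t0.
have [|cj qj] := ph j t.
  by split=> //; apply: Jt; rewrite t0 ltW.
exists (swidx s j) => //; apply: cvg_trans qj; apply: cvg_app.
move=> A hA.
have ts : \forall r \near t^'+, (r%:E < swtime s j.+1)%E.
  case: (swtime s j.+1) tj => [u|_|//]; last by near=> r; exact: ltry.
  rewrite lte_fin => tu.
  by near=> r; rewrite lte_fin; near: r; exact: nbhs_right_lt.
have {}hA : \forall r \near t^'+, r != t -> phase s J j r -> A r.
  have : \forall r \near t, r != t -> phase s J j r -> A r by exact: hA.
  by apply: filterS => r h _.
near=> r.
have tr : t < r by near: r; exact: nbhs_right_gt.
have rb : r <= b by near: r; exact: nbhs_right_le.
have rS : (r%:E < swtime s j.+1)%E by near: r.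
have: r != t -> phase s J j r -> A r by near: r.
apply; first by rewrite gt_eqF.
split; first by apply: Jt; rewrite rb (le_trans t0 (ltW tr)).
by split=> //; apply: le_trans sj _; rewrite lee_fin ltW.
Unshelve. all: by end_near. Qed.

Lemma trajectory_continuous s x J phi a b :
  trajectory S s x J phi -> J b -> 0 <= a ->
  {within `[a, b], continuous phi}.
Proof.
move=> [[Jitv J0 _] _ phiC _ _] Jb a0.
apply: continuous_subspaceW phiC => t; rewrite /= in_itv /= => /andP[at_ tb].
by apply: Jitv J0 Jb _ _; rewrite tb (le_trans a0 at_).
Qed.

Context {V : 'rV[R]_d -> R} {gradV : 'rV[R]_d -> 'rV[R]_d}.
Context (hV : C1_on (dom S) V gradV).

Lemma lyapunov_decrease s x J phi a b c :
  trajectory S s x J phi -> J b -> 0 <= a <= b ->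
  (forall t, a <= t <= b -> interior (dom S) (phi t)) ->
  (forall t i, a <= t <= b -> cell S i (phi t) ->
     dot (gradV (phi t)) (field S i (phi t)) <= c) ->
  V (phi b) - V (phi a) <= c * (b - a).
Proof.
move=> tr Jb /andP[a0 ab] phiI Vc; have [_ _ Vd] := hV.
apply: (@right_slope_le _ (V \o phi)) => //.
  apply/subspace_continuousP => t abt.
  have /subspace_continuousP phiC := trajectory_continuous _ _ _ _ _ _ tr Jb a0.
  have [|Vdt _] := Vd (phi t).
    by apply: phiI; move: abt; rewrite /= in_itv.
  by apply: continuous_cvg; [exact: differentiable_continuous|exact: phiC].
move=> t /andP[at_ tb].
have abt : a <= t <= b by rewrite at_ ltW.
have [|i ci qi] := trajectory_right_derivative _ _ _ _ t _ tr Jb.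
  by rewrite tb (le_trans a0).
have [Vdt Vg] := Vd _ (phiI _ abt).
exists ('d V (phi t) (field S i (phi t))); first exact: right_derivative_comp.
by rewrite Vg; exact: Vc.
Qed.

Context (hdec : forall i y, cell S i y -> dot (gradV y) (field S i y) <= 0).

(** A motion in the set at some time is there in the open set [O], so it remains
    in [O] for a short time, during which [V] does not increase. *)
Lemma sublevel_trap O c s x J phi a b :
  open O -> O `<=` dom S -> closed (sublevel V O c) ->
  trajectory S s x J phi -> J b -> 0 <= a <= b ->
  sublevel V O c (phi a) -> sublevel V O c (phi b).
Proof.
move=> Oo OS Kcl tr Jb /andP[a0 ab] Ka.
have [[Jitv J0 _] _ _ _ _] := tr.
have phiC := trajectory_continuous _ _ _ _ _ _ tr Jb a0.
apply: (closed_continuation _ _ phi _ _ _ ab) => // t /andP[at_ tb] [Ot Vt].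
have abt : `[a, b]%classic t by rewrite /= in_itv /= at_ ltW.
have /subspace_continuousP/(_ t abt O) := phiC.
case; first exact: open_nbhs_nbhs.
move=> e /= e0 he.
set r := Num.min b (t + e / 2).
have tltr : t < r by rewrite lt_min tb ltrDl divr_gt0.
have rb : r <= b by rewrite ge_min lexx.
have rO u : t <= u <= r -> O (phi u).
  move=> /andP[tu ur]; apply: he; last first.
    by rewrite in_itv /= (le_trans at_ tu) (le_trans ur rb).
  rewrite /= ler0_norm ?subr_le0 // opprB ltrBlDl (le_lt_trans ur) //.
  by rewrite gt_min ltrD2l ltr_pdivrMr // mulr2n mulrDr mulr1 ltrDl e0 orbT.
exists r; first by rewrite tltr.
split; first by apply: rO; rewrite lexx ltW.
apply: le_trans Vt; rewrite /= -subr_le0 -(mul0r (r - t)).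
apply: (lyapunov_decrease s x J) => //.
- by apply: Jitv J0 Jb _ _; rewrite rb (le_trans a0) // (le_trans at_) // ltW.
- by rewrite (le_trans a0 at_) ltW.
- by move=> u /rO; move: (phi u); rewrite -/(O `<=` _) -open_subsetE.
- by move=> u i _; exact: hdec.
Qed.

(** A trapped motion never leaves a compact subset of the interior, which rules
    out the exit from the domain, the only reason for a finite lifespan. *)
Lemma sublevel_motion O c s x J phi :
  open O -> O `<=` dom S -> compact (sublevel V O c) -> sublevel V O c x ->
  motion S s x J phi ->
  J = [set t | 0 <= t] /\ forall t, 0 <= t -> sublevel V O c (phi t).
Proof.
move=> Oo OS Kc Kx [[tr _] ends].
have Kcl : closed (sublevel V O c)
  by apply: compact_closed => //; exact: norm_hausdorff.
have [[Jitv J0 Jge] phi0 _ _ _] := tr.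
have KJ t : J t -> sublevel V O c (phi t).
  move=> Jt.
  apply: (sublevel_trap O c s x J phi 0 t) => //; last by rewrite phi0.
  by rewrite lexx Jge.
have KI : sublevel V O c `<=` interior (dom S).
  by apply: subset_trans (@subIsetl _ _ _) _; rewrite -open_subsetE.
suff JE : J = [set t | 0 <= t] by split=> // t t0; apply: KJ; rewrite JE.
case: ends => // /(_ _ Kc KI 0 J0)[t Jt [_ nK]].
by case: nK; exact: KJ.
Qed.

End Lyapunov.

(** * The Euclidean norm *)

Section EuclideanNorm.
Context {R : realType} {d : nat}.

Lemma norm_le_enorm (u : 'rV[R]_d) : `|u| <= enorm u.
Proof.
rewrite /Num.norm /= mx_normrE; apply: bigmax_le => [|[i j] _] /=.
  by rewrite sqrtr_ge0.
rewrite -sqrtr_sqr ler_wsqrtr // /dot (bigD1 j) //= ord1 expr2 lerDl.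
by apply: sumr_ge0 => l _; rewrite -expr2 sqr_ge0.
Qed.

Lemma enorm_le_norm (u : 'rV[R]_d) : enorm u <= d.+1%:R * `|u|.
Proof.
have u0 : 0 <= d.+1%:R * `|u| by rewrite mulr_ge0.
rewrite -[leRHS]ger0_norm // -sqrtr_sqr ler_wsqrtr //.
have uj j : u 0 j * u 0 j <= `|u| ^+ 2.
  rewrite -expr2 -real_normK ?num_real // ler_pXn2r ?nnegrE //.
  rewrite [leRHS]/Num.norm /= mx_normrE.
  by apply: (le_bigmax _ (fun ij : 'I_1 * 'I_d => `|u ij.1 ij.2|) (0, j)).
apply: le_trans (ler_sum _ (fun j _ => uj j)) _.
rewrite sumr_const card_ord exprMn -[leLHS]mulr_natl ler_wpM2r ?sqr_ge0 //.
by rewrite -natrX ler_nat expnS (leq_trans (leqnSn d)) // leq_pmulr.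
Qed.

Lemma dot_cvg {T : Type} {F : set_system T} {FF : Filter F}
    (f g : T -> 'rV[R]_d) (u v : 'rV[R]_d) :
  f @ F --> u -> g @ F --> v -> dot (f t) (g t) @[t --> F] --> dot u v.
Proof.
move=> fu gv; rewrite /dot.
apply: cvg_big => [|i _]; first exact: add_continuous.
have coordC := @coord_continuous R 1 d 0 i.
apply: cvgM.
  exact: (cvg_comp f (fun M : 'rV[R]_d => M 0 i) fu (coordC _)).
exact: (cvg_comp g (fun M : 'rV[R]_d => M 0 i) gv (coordC _)).
Qed.

End EuclideanNorm.

(** * Stability and attraction *)

Section LyapunovStability.
Context {R : realType} {d k : nat} {S : switched_system R d k}.
Implicit Types (s : switching R k) (x y : 'rV[R]_d) (J : set R)
  (phi : R -> 'rV[R]_d) (O C : set 'rV[R]_d).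
Context {V : 'rV[R]_d -> R} {gradV : 'rV[R]_d -> 'rV[R]_d}.
Context (hV : C1_on (dom S) V gradV).
Context {alpha : R}.
Context (hS : standing_assumptions alpha S).

Lemma field_continuous i : {within cell S i, continuous (field S i)}.
Proof.
have [U [F [Uo cU FU fF]]] := field_class hS i.
have FC x : U x -> {for x, continuous F}.
  move=> Ux; move: FU; rewrite /C_class.
  by case: (Num.truncn _) => [|m] /= [FC _]; exact: FC.
apply/subspace_continuousP => x cx.
suff: field S i y @[y --> within (cell S i) (nbhs x)] --> F x by rewrite -fF.
have Fx : F y @[y --> within (cell S i) (nbhs x)] --> F x.
  by apply: cvg_within_filter; apply: FC; exact: cU.
apply: cvg_trans Fx.
apply: near_eq_cvg; near=> y; rewrite fF //.
by near: y; exact: withinT.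
Unshelve. all: by end_near. Qed.

Context {gamma : R -> R}.
Context (hgamma : forall r, r != 0 -> 0 < gamma r).
Context (hlyap : forall i x, cell S i x -> x != 0 ->
  dot (gradV x) (field S i x) <= - gamma (enorm x) /\ 0 < V x).
Context (hV0 : V 0 = 0).

Lemma lyapunov_neg i y : cell S i y -> y != 0 ->
  dot (gradV y) (field S i y) < 0.
Proof.
move=> cy y0; have [le_g _] := hlyap _ _ cy y0.
apply: le_lt_trans le_g _; rewrite oppr_lt0 hgamma //.
by rewrite gt_eqF // (lt_le_trans _ (norm_le_enorm y)) // normr_gt0.
Qed.

Lemma lyapunov_gt0 y : dom S y -> y != 0 -> 0 < V y.
Proof.
by rewrite -(cell_cover hS) => -[i _ cy] y0; have [] := hlyap _ _ cy y0.
Qed.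

Lemma lyapunov_ge0 y : dom S y -> 0 <= V y.
Proof.
have [->|y0 Sy] := eqVneq y 0; first by rewrite hV0.
by apply: ltW; exact: lyapunov_gt0.
Qed.

(** On the compact trace of each cell on [C], the continuous function
    [dot gradV field] has a negative maximum, since the origin is not in [C];
    a common bound for the finitely many fields is found among the small
    positive numbers. *)
Lemma lyapunov_strict C : compact C -> C `<=` dom S -> ~ C 0 ->
  exists2 mu, 0 < mu & forall i y, C y -> cell S i y ->
    dot (gradV y) (field S i y) <= - mu.
Proof.
move=> Cc CS C0; have [_ gC _] := hV.
suff : \forall mu \near 0^'+, forall i y, C y -> cell S i y ->
    dot (gradV y) (field S i y) <= - mu.
  move=> h; have : \forall mu \near (0 : R)^'+, 0 < mu /\
      forall i y, C y -> cell S i y -> dot (gradV y) (field S i y) <= - mu.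
    by near=> mu; split; near: mu => //; exact: nbhs_right_gt.
  by move=> /filter_ex[mu [mu0 hmu]]; exists mu.
apply: filter_forall => i.
have [F Fcl cF] := cell_closed hS i.
have CiE : C `&` cell S i = C `&` F.
  rewrite cF; apply/seteqP; split=> [y [Cy [_ Fy]]|y [Cy Fy]] //.
  by split=> //; split=> //; exact: CS.
have Cic : compact (C `&` cell S i).
  by rewrite CiE; exact: compact_closedI.
have [Ci0|/set0P Ci0] := eqVneq (C `&` cell S i) set0; last first.
  pose f y := dot (gradV y) (field S i y).
  have [|y0 /set_mem[Cy0 cy0] ymax] := compact_EVT_max (f := f) Ci0 Cic.
    have sC : C `&` cell S i `<=` dom S by move=> y [/CS].
    have sc : C `&` cell S i `<=` cell S i by move=> y [].
    have /subspace_continuousP gCi := continuous_subspaceW sC gC.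
    have /subspace_continuousP fCi :=
      continuous_subspaceW sc (field_continuous i).
    apply/subspace_continuousP => y Cy.
    by apply: dot_cvg; [exact: gCi|exact: fCi].
  have y0N : y0 != 0 by apply/eqP => y00; apply: C0; rewrite -y00.
  have := lyapunov_neg _ _ cy0 y0N; rewrite -oppr_gt0 => neg.
  near=> mu => y Cy cy; apply: le_trans (ymax y _) _; first by rewrite inE.
  by rewrite lerNr; near: mu; exact: nbhs_right_le.
near=> mu => y Cy cy.
by have : set0 y by rewrite -Ci0.
Unshelve. all: by end_near. Qed.

(** At the origin the bound comes from the equilibrium condition, since the
    hypothesis on [V] is about the other points only. *)
Lemma lyapunov_nonpos i y : cell S i y -> dot (gradV y) (field S i y) <= 0.
Proof.
have [->|y0 cy] := eqVneq y 0; last by apply: ltW; exact: (lyapunov_neg i).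
move=> /(field_origin hS) ->; rewrite /dot big1 // => j _.
by rewrite mxE mulr0.
Qed.

(** Take for [O] a small ball and for [c] a positive number less than the
    minimum of [V] on the boundary sphere: a point of the closed ball with
    [V <= c] is then off the sphere, so the sublevel set is closed although
    [O] is open. *)
Lemma small_sublevel eps : 0 < eps -> exists O c,
  [/\ 0 < c, open O, O 0, O `<=` dom S &
      O `<=` [set y | `|y| < eps] /\ compact (sublevel V O c)].
Proof.
move=> eps0; have [_ _ Vd] := hV.
have : nbhs (0 : 'rV[R]_d) (interior (dom S)).
  by apply: open_nbhs_nbhs; split; [exact: open_interior|exact: dom_origin hS].
move=> /nbhs_ballP[r0 /= r00 r0S].
pose r := Num.min eps r0 / 2.
have m0 : 0 < Num.min eps r0 by rewrite lt_min eps0.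
have rpos : 0 < r by rewrite divr_gt0.
have rm : r < Num.min eps r0 by rewrite ltr_pdivrMr // ltr_pMr // ltr1n.
have [re rr0] : r < eps /\ r < r0 by apply/andP; rewrite -lt_min.
have BI y : `|y| <= r -> interior (dom S) y.
  move=> yr; apply: r0S; rewrite -ball_normE /= sub0r normrN.
  exact: le_lt_trans yr rr0.
have VC y : `|y| <= r -> {for y, continuous V}.
  by move=> /BI/Vd[Vy _]; exact: differentiable_continuous.
have normC : continuous (fun y : 'rV[R]_d => `|y|) by exact: norm_continuous.
have Bb (A : set 'rV[R]_d) : A `<=` [set y | `|y| <= r] -> bounded_set A.
  move=> Ar; exists r; split; first exact: num_real.
  by move=> M rM y /Ar /= yr; exact: le_trans yr (ltW rM).
have Sc : compact [set y : 'rV[R]_d | `|y| = r].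
  apply: bounded_closed_compact; first by apply: Bb => y /= ->.
  apply: (@preimage_closed _ _ (fun y : 'rV[R]_d => `|y|) [set u | u = r]).
    by move=> y _; exact: normC.
  exact: closed_eq.
(* The sphere is empty in dimension 0. *)
have [c c0 cS] : exists2 c, 0 < c & forall y : 'rV[R]_d, `|y| = r -> c < V y.
  have [S0|/set0P S0] := eqVneq [set y : 'rV[R]_d | `|y| = r] set0.
    exists 1 => // y yr; by have : set0 y by rewrite -S0.
  have [|y0 /set_mem/= y0r ymin] := EVT_min_rV (f := V) S0 Sc.
    apply/subspace_continuousP => y /= yr; apply: cvg_within_filter.
    by apply: VC; rewrite yr.
  have Vy0 : 0 < V y0.
    apply: lyapunov_gt0.
      by apply: interior_subset; apply: BI; rewrite y0r.
    by rewrite -normr_gt0 y0r.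
  exists (V y0 / 2); first by rewrite divr_gt0.
  move=> y yr; apply: lt_le_trans (ymin y _); last by rewrite inE.
  by rewrite ltr_pdivrMr // ltr_pMr // ltr1n.
exists [set y | `|y| < r], c; split=> //.
- apply: (@open_comp _ _ (fun y : 'rV[R]_d => `|y|) [set u | u < r]).
    by move=> y _; exact: normC.
  exact: open_lt.
- by rewrite /= normr0.
- by move=> y /= /ltW/BI/interior_subset.
split; first by move=> y /= yr; exact: lt_trans yr re.
have -> : sublevel V [set y | `|y| < r] c = [set y | `|y| <= r /\ V y <= c].
  apply/seteqP; split=> [y [/= /ltW]//|y /= [yr Vy]]; split=> //=.
  rewrite lt_neqAle yr andbT; apply/eqP => /cS.
  by rewrite ltNge Vy.
apply: bounded_closed_compact; first by apply: Bb => y [].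
rewrite -openC openE => y /= nKy.
have [yr|yr] := leP `|y| r.
  have : \forall z \near y, c < V z.
    apply: (@cvgr_gt _ _ (nbhs y) _ V (V y)); first exact: VC.
    by rewrite ltNge; apply/negP => Vy; exact: nKy.
  by apply: filterS => z cz [_]; rewrite leNgt cz.
have : \forall z \near y, r < `|z|.
  by apply: (@cvgr_gt _ _ (nbhs y) _ (fun z => `|z|) `|y|) => //; exact: normC.
by apply: filterS => z rz [+ _]; rewrite leNgt rz.
Qed.

Lemma sublevel_nbhs O c :
  open O -> O 0 -> 0 < c -> nbhs (0 : 'rV[R]_d) (sublevel V O c).
Proof.
move=> Oo O0 c0; apply: filterI; first exact: open_nbhs_nbhs.
have [_ _ /(_ 0 (dom_origin hS))[V0 _]] := hV.
have : \forall z \near (0 : 'rV[R]_d), V z < c.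
  apply: (@cvgr_lt _ _ (nbhs (0 : 'rV[R]_d)) _ V (V 0)); last by rewrite hV0.
  exact: differentiable_continuous.
by apply: filterS => z /= /ltW.
Qed.

(** The time [T] depends neither on the initial point nor on the switching.
    Outside a neighbourhood of the origin contained in a small trapping set, [V]
    decreases at a uniform rate; as it starts below [c] and stays nonnegative,
    the motion enters the neighbourhood before [T]. *)
Lemma sublevel_attraction O c eps :
  open O -> O `<=` dom S -> compact (sublevel V O c) -> 0 < eps ->
  exists2 T, 0 < T & forall s x J phi, motion S s x J phi ->
    sublevel V O c x -> forall t, T < t -> `|phi t| < eps.
Proof.
move=> Oo OS Kc eps0.
have [U [c' [c'0 Uo U0 US [Ueps K'c]]]] := small_sublevel eps eps0.
have K'cl : closed (sublevel V U c')
  by apply: compact_closed => //; exact: norm_hausdorff.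
have Kcl : closed (sublevel V O c)
  by apply: compact_closed => //; exact: norm_hausdorff.
have [D [Do D0] DK'] :
    exists2 D, open_nbhs (0 : 'rV[R]_d) D & D `<=` sublevel V U c'.
  by have := sublevel_nbhs U c' Uo U0 c'0; rewrite nbhsE.
have Cc : compact (sublevel V O c `&` ~` D).
  by apply: compact_closedI => //; exact: open_closedC.
have [| |mu mu0 Cmu] := lyapunov_strict _ Cc.
- by move=> y [[/OS]].
- by move=> [_].
(* At the rate [mu], [V] would drop by [`|c| + 1 > c] during [T]. *)
pose T := (`|c| + 1) / mu.
have T0 : 0 < T by rewrite divr_gt0 // ltr_wpDl.
exists T => // s x J phi mot Kx t Tt.
have [JE phiK] :=
  sublevel_motion hV lyapunov_nonpos _ _ _ _ _ _ Oo OS Kc Kx mot.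
have [[tr _] _] := mot.
have Jr r : 0 <= r -> J r by rewrite JE.
have [[t0 /andP[t00 t0T] Dt0]|nD] :=
  pselect (exists2 t0, 0 <= t0 <= T & D (phi t0)).
  suff [/Ueps] : sublevel V U c' (phi t) by [].
  apply: (sublevel_trap hV lyapunov_nonpos U c' s x J phi t0 t) => //.
  - by apply: Jr; rewrite (le_trans (ltW T0)) // ltW.
  - by rewrite t00 (le_trans t0T) // ltW.
  - exact: DK'.
have phiC r : 0 <= r <= T -> (sublevel V O c `&` ~` D) (phi r).
  move=> rT; split; first by apply: phiK; case/andP: rT.
  by move=> Dr; apply: nD; exists r.
have : V (phi T) - V (phi 0) <= - mu * (T - 0).
  apply: (lyapunov_decrease hV s x J) => //.
  - exact/Jr/ltW.
  - by rewrite lexx ltW.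
  - move=> r /phiC[[+ _] _]; move: (phi r); rewrite -/(O `<=` _).
    by rewrite -open_subsetE.
  - by move=> r i /phiC Cr ci; exact: Cmu.
have VT : 0 <= V (phi T).
  by apply: lyapunov_ge0; apply: OS; have [] := phiK T (ltW T0).
have [_ Vx] := Kx; have [_ phi0 _ _ _] := tr; rewrite phi0.
have -> : - mu * (T - 0) = - (`|c| + 1).
  by rewrite subr0 mulNr /T mulrC mulfVK // gt_eqF.
have := ler_norm c; move: Vx => /=; lra.
Qed.

End LyapunovStability.

Lemma the_motionP (R : realType) (d k : nat) (S : switched_system R d k)
    (s : switching R k) (x : 'rV[R]_d) :
  Sigma S x s -> motion S s x (lifespan S s x) (flow S s x).
Proof.
move=> [J [phi mot]].
have := @xgetPex _ (set0, cst 0) [set p | motion S s x p.1 p.2].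
by apply; exists (J, phi).
Qed.

Theorem theorem2p7 (R : realType) (d k : nat) (alpha : R)
    (S : switched_system R d k) (hS : standing_assumptions alpha S)
    (V : 'rV[R]_d -> R) (gradV : 'rV[R]_d -> 'rV[R]_d)
    (hV : C1_on (dom S) V gradV) (hV0 : V 0 = 0)
    (gamma : R -> R) (hgamma : forall r, r != 0 -> 0 < gamma r)
    (hlyap : forall i x, cell S i x -> x != 0 ->
       dot (gradV x) (field S i x) <= - gamma (enorm x) /\ 0 < V x) :
  uniformly_asymptotically_stable S /\
  forall rho : R, 0 < rho ->
    let S_rho := [set x | dom S x /\ V x <= rho] in
    S_rho `<=` interior (dom S) -> compact S_rho ->
    S_rho `<=` basin S.
Proof.
have nonpos := lyapunov_nonpos hS hgamma hlyap.
have small := small_sublevel hV hS hlyap.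
have attract := sublevel_attraction hV hS hgamma hlyap hV0.
have nbhs0 (O : set 'rV[R]_d) (c : R) : open O -> O 0 -> 0 < c ->
    exists2 delta, 0 < delta & forall x, enorm x < delta -> sublevel V O c x.
  move=> Oo O0 c0.
  have /nbhs_ballP[e /= e0 eK] := sublevel_nbhs hV hS hV0 O c Oo O0 c0.
  exists e => // x xe; apply: eK; rewrite -ball_normE /= sub0r normrN.
  exact: le_lt_trans (norm_le_enorm x) xe.
have enorm_lt (eps : R) : 0 < eps -> exists2 e, 0 < e &
    forall u : 'rV[R]_d, `|u| < e -> enorm u < eps.
  move=> eps0; exists (eps / d.+1%:R); first by rewrite divr_gt0.
  move=> u ue; apply: le_lt_trans (enorm_le_norm u) _.
  by rewrite mulrC -ltr_pdivlMr.
split.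
  split=> [eps /enorm_lt[e e0 ee]|].
    have [W [c [c0 Wo W0 WS [We Kc]]]] := small _ e0.
    have [delta delta0 dK] := nbhs0 W c Wo W0 c0.
    exists delta => // t t0 x _ /dK Kx s /the_motionP mot.
    have [-> phiK] := sublevel_motion hV nonpos _ _ _ _ _ _ Wo WS Kc Kx mot.
    by split=> //; apply: ee; apply: We; have [] := phiK _ t0.
  have [W [c [c0 Wo W0 WS [_ Kc]]]] := small _ (@ltr01 R).
  have [delta delta0 dK] := nbhs0 W c Wo W0 c0.
  exists delta => // eps /enorm_lt[e e0 ee].
  have [T T0 hT] := attract W c e Wo WS Kc e0.
  exists T => // t Tt x _ /dK Kx s /the_motionP mot.
  have [-> _] := sublevel_motion hV nonpos _ _ _ _ _ _ Wo WS Kc Kx mot.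
  split; first exact: ltW (lt_trans T0 Tt).
  exact/ee/(hT _ _ _ _ mot).
move=> rho rho0 /= SI Sc x Sx.
have KE : sublevel V (interior (dom S)) rho = [set x | dom S x /\ V x <= rho].
  apply/seteqP; split=> y [Sy Vy]; split=> //; first exact: interior_subset.
  exact: SI.
have Oo : open (interior (dom S)) by exact: open_interior.
have OS : interior (dom S) `<=` dom S by exact: interior_subset.
rewrite -KE in Sc; have Kx : sublevel V (interior (dom S)) rho x by rewrite KE.
split; first by case: Sx.
move=> s /the_motionP mot.
have [-> _] := sublevel_motion hV nonpos _ _ _ _ _ _ Oo OS Sc Kx mot.
split=> //; apply/cvgr0Pnorm_lt => eps eps0.
have [T T0 hT] := attract _ _ _ Oo OS Sc eps0.
by exists T; split; [exact: num_real|move=> t Tt; exact: hT mot _ _ Tt].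
Qed.
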